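(* Assume $|V|\ge2$ and let $\overline\kappa_0=\inf_{x\ne y}\overline\kappa(x,y)$. Then for every $f\in\mathrm{Lip}^1_w(V)$, all $x,y\in V$ and all $t>0$, $$\frac{h_tf(x)}{d_x}-\frac{h_tf(y)}{d_y}\le e^{-\overline\kappa_0t}\,d(x,y).$$
   Context: Let $H=(V,E,w)$ be a weighted hypergraph: $V$ is a finite set, $E$ a set of nonempty subsets of $V$, $w\colon E\to\mathbb{R}_{>0}$. Write $x\sim y$ if some $e\in E$ contains both; $H$ is assumed connected. The degree is $d_x=\sum_{e\ni x}w_e>0$, $D=\mathrm{diag}(d_x)$. The distance $d(x,y)$ is the minimal $n$ with a chain $x=z_0\sim\cdots\sim z_n=y$. $\delta_x$ is the indicator of $x$. $\mathbb{R}^V$ carries the inner product $\langle f,g\rangle=\sum_x f(x)g(x)/d_x$ with norm $\|\cdot\|$. For $e\in E$ let $B_e=\mathrm{Conv}\{\delta_x-\delta_y : x,y\in e\}$. The multivalued hypergraph Laplacian is $L(f)=\{\sum_{e}w_e\mathtt{b}_e(\mathtt{b}_e^\top f) : \mathtt{b}_e\in\operatorname{argmax}_{\mathtt b\in B_e}\mathtt b^\top f\}$ and the normalized Laplacian is $\mathcal{L}f=L(D^{-1}f)$, a maximal monotone operator on $(\mathbb{R}^V,\langle\cdot,\cdot\rangle)$. For $\lambda>0$ the resolvent $J_\lambda=(I+\lambda\mathcal L)^{-1}$ is a single-valued map $\mathbb{R}^V\to\mathbb{R}^V$ (equivalently $J_\lambda f=\operatorname{argmin}_g\{\frac{1}{2\lambda}\|f-g\|^2+Q(D^{-1}g)\}$,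 $Q(g)=\frac12\sum_e w_e\max_{x,y\in e}(g(x)-g(y))^2$). The heat semigroup $h_t=e^{-t\mathcal L}$ is given by $h_tf=\lim_{\lambda\downarrow0}J_\lambda^{[t/\lambda]}f$ for $t>0$, $[a]$ the integer part. A function $f$ is weighted $1$-Lipschitz if $|f(x)/d_x-f(y)/d_y|\le d(x,y)$ for all $x,y$; $\mathrm{Lip}^1_w(V)$ denotes the set of such functions. $\mathrm{KD}_\lambda(x,y)=\sup\{\langle J_\lambda f,\delta_x-\delta_y\rangle : f\in\mathrm{Lip}^1_w(V)\}$. For $x\ne y$: $\kappa_\lambda(x,y)=1-\mathrm{KD}_\lambda(x,y)/d(x,y)$ and $\overline\kappa(x,y)=\limsup_{\lambda\downarrow0}\kappa_\lambda(x,y)/\lambda$. *)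

(* Defs.v *)
From HB Require Import structures.
From mathcomp Require Import all_boot all_order all_algebra.
From mathcomp Require Import all_classical all_reals all_analysis.
Set Implicit Arguments. Unset Strict Implicit. Unset Printing Implicit Defensive.
Import Order.TTheory GRing.Theory Num.Theory.
Import numFieldNormedType.Exports.
Local Open Scope classical_set_scope.
Local Open Scope ring_scope.

Section Hypergraph.
Variables (R : realType) (V : finType) (E : {set {set V}}) (w : {set V} -> R).

Definition wf_hypergraph : Prop :=
  (forall e, e \in E -> (0 < #|e|)%N) /\ (forall e, e \in E -> 0 < w e).

Definition adj (x y : V) : bool := [exists e in E, (x \in e) && (y \in e)].

Fixpoint chainb (n : nat) (x y : V) : bool :=
  if n is n'.+1 then [exists z, adj x z && chainb n' z y] else x == y.

Definition connected_hg : Prop := forall x y : V, exists n, chainb n x y.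

(* d(x,y) = minimal n with a chain of length n; on a connected hypergraph
   the minimal chain has length < #|V|, so taking the min over n < #|V| is exact *)
Definition hdist (x y : V) : nat :=
  \big[minn/#|V|]_(n < #|V| | chainb n x y) n.

Definition deg (x : V) : R := \sum_(e in E | x \in e) w e.

Definition ip (f g : V -> R) : R := \sum_x f x * g x / deg x.

Definition delta (x : V) : V -> R := fun z => (z == x)%:R.

Definition dotp (b f : V -> R) : R := \sum_x b x * f x.

(* B_e = Conv { delta_x - delta_y : x, y in e } *)
Definition Bset (e : {set V}) : set (V -> R) :=
  [set b | exists c : V * V -> R,
     [/\ forall p, 0 <= c p,
         forall p, ~~ ((p.1 \in e) && (p.2 \in e)) -> c p = 0,
         \sum_p c p = 1 &
         b = fun z => \sum_p c p * (delta p.1 z - delta p.2 z)]].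

Definition argmaxB (e : {set V}) (f : V -> R) : set (V -> R) :=
  [set b | Bset e b /\ forall b', Bset e b' -> dotp b' f <= dotp b f].

Definition Lap (f : V -> R) : set (V -> R) :=
  [set u | exists bb : {set V} -> (V -> R),
     (forall e, e \in E -> argmaxB e f (bb e)) /\
     u = fun z => \sum_(e in E) w e * bb e z * dotp (bb e) f].

Definition nLap (f : V -> R) : set (V -> R) := Lap (fun z => f z / deg z).

(* resolvent J_lambda = (I + lambda cL)^{-1}: the (unique) g with f ∈ g + lambda cL g *)
Definition resolvent (lam : R) (f : V -> R) : V -> R :=
  xget (fun _ => 0) [set g | exists u, nLap g u /\ f = fun z => g z + lam * u z].

Definition heat (t : R) (f : V -> R) : V -> R :=
  fun z => lim ((fun lam : R => iter (Num.truncn (t / lam)) (resolvent lam) f z) @ 0^'+).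

Definition Lipw (f : V -> R) : Prop :=
  forall x y, `|f x / deg x - f y / deg y| <= (hdist x y)%:R.

Definition KD (lam : R) (x y : V) : R :=
  sup [set ip (resolvent lam f) (fun z => delta x z - delta y z) | f in Lipw].

Definition kappa (lam : R) (x y : V) : R := 1 - KD lam x y / (hdist x y)%:R.

Definition kappabar (x y : V) : \bar R :=
  limf_esup (fun lam : R => (kappa lam x y / lam)%:E) 0^'+.

Definition kappa0 : \bar R :=
  ereal_inf [set kappabar p.1 p.2 | p in [set p : V * V | p.1 != p.2]].

End Hypergraph.

(* Main.v *)
Require Import Defs.
From HB Require Import structures.
From mathcomp Require Import all_boot all_order all_algebra.
From mathcomp Require Import all_classical all_reals all_analysis.
From mathcomp Require Import ring lra.
Set Implicit Arguments. Unset Strict Implicit. Unset Printing Implicit Defensive.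
Import Order.TTheory GRing.Theory Num.Theory.
Import numFieldNormedType.Exports.
Local Open Scope classical_set_scope.
Local Open Scope ring_scope.

(** The quantity [F_xy(g) = g x / d_x - g y / d_y] is [ip g (delta_x - delta_y)].
    Write [A_l = (I - J_l) / l] for the Yosida approximations.  Fix [t] and let
    [g] be the flow at time [t], scaled so that it is weighted 1-Lipschitz.  At an
    active pair, where [F_xy(g) = d(x,y)], the definition of [KD] gives
    [F_xy(A_l g) >= d(x,y) kappa_l(x,y) / l] for every [l > 0].  Since [|A_l g|]
    increases to a finite limit as [l] decreases to 0, the difference quotients of
    the flow at [g] over short times are close to [- A_l g] for every small [l]; so
    it is enough that [kappa_l / l] is almost [kappabar(x,y)] for arbitrarily small
    [l], which is what the limsup provides, although the good values of [l] depend
    on the pair.  Hence [F_xy] decays at rate at least [kappa0 - eps] at each active pair,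
    and the Lipschitz constant stays below the barrier [exp (- (kappa0 - eps) t)]. *)

Lemma cvg_sumr (R : realType) (I : finType) (T : Type) (F : set_system T)
    (FF : Filter F) (u : I -> T -> R) (a : I -> R) :
  (forall i, u i t @[t --> F] --> a i) ->
  \sum_i u i t @[t --> F] --> \sum_i a i.
Proof.
by move=> h; apply: cvg_big => [|i _]; [exact: add_continuous|exact: h].
Qed.

(** * The inner product weighted by inverse degrees *)

Section InnerProduct.
Variables (R : realType) (V : finType) (E : {set {set V}}) (w : {set V} -> R).
Hypothesis deg_gt0 : forall x, 0 < deg E w x.
Implicit Types (f g h : V -> R) (c : R).
Local Notation ip := (ip E w).

Lemma ipC f g : ip f g = ip g f.
Proof. by apply: eq_bigr => x _; rewrite (mulrC (f x)). Qed.

Lemma ipDl f g h : ip (f + g) h = ip f h + ip g h.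
Proof. by rewrite /ip -big_split; apply: eq_bigr => x _ /=; rewrite !fctE; ring. Qed.

Lemma ipZl c f h : ip (c *: f) h = c * ip f h.
Proof. by rewrite /ip mulr_sumr; apply: eq_bigr => x _ /=; rewrite -!mulrA. Qed.

Lemma ip0l h : ip 0 h = 0.
Proof. by rewrite -(scale0r (0 : V -> R)) ipZl mul0r. Qed.

Lemma ip0r h : ip h 0 = 0.
Proof. by rewrite ipC ip0l. Qed.

Lemma ipNl f h : ip (- f) h = - ip f h.
Proof. by rewrite -scaleN1r ipZl mulN1r. Qed.

Lemma ipBl f g h : ip (f - g) h = ip f h - ip g h.
Proof. by rewrite ipDl ipNl. Qed.

Lemma ipDr f g h : ip h (f + g) = ip h f + ip h g.
Proof. by rewrite ipC ipDl !(ipC h). Qed.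

Lemma ipZr c f h : ip h (c *: f) = c * ip h f.
Proof. by rewrite ipC ipZl (ipC h). Qed.

Lemma ipBr f g h : ip h (f - g) = ip h f - ip h g.
Proof. by rewrite ipC ipBl !(ipC h). Qed.

Definition ipE := (ipBl, ipBr, ipDl, ipDr, ipZl, ipZr).

Lemma ip_scale c f : ip (c *: f) (c *: f) = c ^+ 2 * ip f f.
Proof. by rewrite ipZl ipZr mulrA. Qed.

Lemma ip_term_ge0 f x : 0 <= f x * f x / deg E w x.
Proof. by rewrite divr_ge0 ?(ltW (deg_gt0 x))// -expr2 sqr_ge0. Qed.

Lemma ip_ge0 f : 0 <= ip f f.
Proof. by apply: sumr_ge0 => x _; exact: ip_term_ge0. Qed.

Lemma sqr_le_ip f z : f z ^+ 2 <= deg E w z * ip f f.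
Proof.
rewrite -ler_pdivrMl ?deg_gt0// mulrC expr2 /Defs.ip (bigD1 z)//= lerDl.
by apply: sumr_ge0 => x _; exact: ip_term_ge0.
Qed.

Lemma ip_le0_eq0 f : ip f f <= 0 -> f = 0.
Proof.
move=> f0; apply: funext => z; apply/eqP; rewrite -sqrf_eq0 eq_le sqr_ge0 andbT.
by apply: (le_trans (sqr_le_ip f z)); rewrite pmulr_rle0.
Qed.

Lemma ip_young c f g : 0 < c -> 2 * ip f g <= c * ip f f + c^-1 * ip g g.
Proof.
move=> c0; have := ip_ge0 (c *: f - g); rewrite !ipE (ipC g f) => h.
rewrite -(ler_pM2l c0) -subr_ge0; apply: le_trans h _.
by rewrite le_eqVlt; apply/orP; left; apply/eqP; field; rewrite gt_eqF.
Qed.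

Lemma ip_young1 f g : 2 * ip f g <= ip f f + ip g g.
Proof. by have := @ip_young 1 f g ltr01; rewrite invr1 !mul1r. Qed.

(** Minkowski's inequality in squared form, which keeps square roots out of the development. Young's
    inequality with weight [b / a] bounds both halves of the cross term by [a * b * N]; if [a] or
    [b] is 0, one summand vanishes. *)
Lemma ip_triangle (N a b : R) f g : 0 <= N -> 0 <= a -> 0 <= b ->
  ip f f <= a ^+ 2 * N -> ip g g <= b ^+ 2 * N ->
  ip (f + g) (f + g) <= (a + b) ^+ 2 * N.
Proof.
move=> N0; rewrite le_eqVlt => /predU1P[<- b0|a0].
  by rewrite expr0n mul0r => /ip_le0_eq0 -> ?; rewrite !add0r.
rewrite le_eqVlt => /predU1P[<- ?|b0 fa gb].
  by rewrite expr0n mul0r => /ip_le0_eq0 ->; rewrite !addr0.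
have := @ip_young (b / a) f g (divr_gt0 b0 a0).
have h1 : (b / a) * ip f f <= a * b * N.
  rewrite (_ : a * b * N = (b / a) * (a ^+ 2 * N)); last by field; rewrite gt_eqF.
  by rewrite ler_pM2l// divr_gt0.
have h2 : (b / a)^-1 * ip g g <= a * b * N.
  rewrite (_ : a * b * N = (b / a)^-1 * (b ^+ 2 * N)).
    by rewrite ler_pM2l// invr_gt0 divr_gt0.
  by field; rewrite !gt_eqF.
rewrite !ipE (ipC g f); nra.
Qed.

Lemma cvg_ip {T : Type} (F : set_system T) {FF : ProperFilter F}
    (u v : T -> V -> R) f g :
  (forall z, u ^~ z @ F --> f z) -> (forall z, v ^~ z @ F --> g z) ->
  (fun t => ip (u t) (v t)) @ F --> ip f g.
Proof.
move=> uf vg; apply: cvg_sumr => x.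
by apply: cvgM; [apply: cvgM|exact: cvg_cst].
Qed.

End InnerProduct.

(** * Monotone operators and the Crandall-Liggett semigroup *)

Section MonotoneOperator.
Variables (R : realType) (V : finType) (E : {set {set V}}) (w : {set V} -> R).
Hypothesis deg_gt0 : forall x, 0 < deg E w x.
Implicit Types (f g h : V -> R) (l m t s : R).
Local Notation ip := (ip E w).
Local Notation sq := (fun f => ip f f).

Variable A : (V -> R) -> set (V -> R).
Hypothesis A_mono : forall g h u v, A g u -> A h v -> 0 <= ip (g - h) (u - v).
Hypothesis A_dom : forall g, A g !=set0.
Variable J : R -> (V -> R) -> (V -> R).
Definition yosida l f : V -> R := l^-1 *: (f - J l f).
Hypothesis A_resolvent : forall l f, 0 < l -> A (J l f) (yosida l f).

Lemma yosidaE l f : 0 < l -> f - J l f = l *: yosida l f.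
Proof. by move=> l0; rewrite scalerA divff ?scale1r// gt_eqF. Qed.

(** Monotonicity is tested at the two resolvent points and multiplied by [l * m]; with
    [D = J l f - J m g] the cross terms are then absorbed by Young's inequality. Different step
    sizes are allowed, as the comparison of two Euler schemes requires. *)
Lemma resolvent_kobayashi l m f g : 0 < l -> 0 < m ->
  (l + m) * sq (J l f - J m g) <= m * sq (f - J m g) + l * sq (J l f - g).
Proof.
move=> l0 m0; have := A_mono (A_resolvent f l0) (A_resolvent g m0).
rewrite /yosida; set X := J l f; set Y := J m g.
rewrite (_ : f - X = (f - Y) - (X - Y)); last by rewrite opprB addrA subrK.
rewrite (_ : g - Y = (X - Y) - (X - g)); last by rewrite opprB [RHS]addrC addrA subrK.
move: (X - Y) (f - Y) (X - g) => D a b.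
have := ip_young1 deg_gt0 D a; have := ip_young1 deg_gt0 D b.
rewrite !ipE => h2 h1 h.
have : 0 <= m * (ip D a - ip D D) + l * (ip D b - ip D D).
  rewrite -(pmulr_rge0 _ (_ : 0 < l^-1 * m^-1)) ?mulr_gt0 ?invr_gt0//.
  apply: le_trans h _; rewrite le_eqVlt; apply/orP; left; apply/eqP.
  by field; rewrite !gt_eqF.
nra.
Qed.

Lemma resolvent_nonexpansive l f g : 0 < l -> sq (J l f - J l g) <= sq (f - g).
Proof.
move=> l0; have := A_mono (A_resolvent f l0) (A_resolvent g l0).
rewrite /yosida -scalerBr; set X := J l f; set Y := J l g.
rewrite (_ : f - X - (g - Y) = (f - g) - (X - Y)); last first.
  by rewrite !opprB addrACA (addrC (- X)) [RHS]addrACA.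
move: (X - Y) (f - g) => D a; have := ip_young1 deg_gt0 D a.
rewrite !ipE pmulr_rge0 ?invr_gt0//; lra.
Qed.

Lemma yosida_le_selection l g u : 0 < l -> A g u -> sq (yosida l g) <= sq u.
Proof.
move=> l0 Agu; have := A_mono Agu (A_resolvent g l0).
rewrite yosidaE//; have := ip_young1 deg_gt0 (yosida l g) u.
move: (yosida l g) => p; rewrite !ipE -mulrBr => h.
by rewrite pmulr_rge0// => h'; lra.
Qed.

(** Both resolvent points start from the same [g], so their difference is [m *: q - l *: p] in the
    Yosida values [p], [q] at [l], [m]. Monotonicity and Young's inequality leave
    [(l - m) * (ip q q - ip p p) >= 0]. *)
Lemma yosida_le l m g : 0 < m -> m <= l -> sq (yosida l g) <= sq (yosida m g).
Proof.
move=> m0; rewrite le_eqVlt => /predU1P[-> //|ml]; have l0 := lt_trans m0 ml.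
have := A_mono (A_resolvent g l0) (A_resolvent g m0).
rewrite (_ : J l g - J m g = m *: yosida m g - l *: yosida l g); last first.
  by rewrite -!yosidaE// opprB [RHS]addrC addrA subrK.
move: (yosida l g) (yosida m g) => p q.
have := ip_young1 deg_gt0 p q; rewrite !ipE (ipC _ _ q p) => hy h.
have {}h : 0 <= (l - m) * (ip q q - ip p p).
  by have := ler_wpM2l (ltW (addr_gt0 l0 m0)) hy; lra.
by move: h; rewrite pmulr_rge0 ?subr_gt0// subr_ge0.
Qed.

Lemma yosida_bounded g : exists2 N, 0 <= N & forall l, 0 < l -> sq (yosida l g) <= N.
Proof.
have [u Agu] := A_dom g; exists (sq u); first exact: ip_ge0.
by move=> l l0; exact: yosida_le_selection.
Qed.

Lemma iter_resolvent_nonexpansive l n f g : 0 < l ->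
  sq (iter n (J l) f - iter n (J l) g) <= sq (f - g).
Proof.
move=> l0; elim: n => //= n; exact/le_trans/resolvent_nonexpansive.
Qed.

(** * Crandall-Liggett estimates for resolvent orbits *)

Section Orbit.
Variables (N : R) (f : V -> R).
Hypothesis N_bound : forall l, 0 < l -> sq (yosida l f) <= N.

Let N_ge0 : 0 <= N.
Proof. exact: le_trans (ip_ge0 deg_gt0 _) (N_bound ltr01). Qed.

Lemma iter_resolvent_step l n : 0 < l ->
  sq (iter n (J l) f - iter n.+1 (J l) f) <= l ^+ 2 * N.
Proof.
move=> l0; rewrite iterSr; apply: le_trans (iter_resolvent_nonexpansive _ _ _ l0) _.
rewrite yosidaE// ip_scale.
by rewrite ler_wpM2l ?N_bound// sqr_ge0.
Qed.

Lemma iter_resolvent_dist l n : 0 < l ->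
  sq (f - iter n (J l) f) <= (n%:R * l) ^+ 2 * N.
Proof.
move=> l0; elim: n => [|n IH].
  by rewrite mul0r expr0n mul0r subrr ip0l.
rewrite -natr1 mulrDl mul1r; rewrite (_ : f - iter n.+1 (J l) f =
  (f - iter n (J l) f) + (iter n (J l) f - iter n.+1 (J l) f)); last first.
  by rewrite addrA subrK.
apply: (ip_triangle deg_gt0) => //; rewrite ?mulr_ge0 ?ler0n ?(ltW l0)//.
exact: iter_resolvent_step.
Qed.

(** Double induction: the edges [i = 0] and [j = 0] measure the distance of an orbit from its start,
    and [resolvent_kobayashi] bounds the value at [(i+1, j+1)] by a weighted mean of those at
    [(i, j+1)] and [(i+1, j)]. *)
Lemma iter_resolvent_cauchy l m i j : 0 < l -> 0 < m ->
  sq (iter i (J l) f - iter j (J m) f) <=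
  ((i%:R * l - j%:R * m) ^+ 2 + i%:R * l ^+ 2 + j%:R * m ^+ 2) * N.
Proof.
move=> l0 m0; elim: i j => [|i IHi] j.
  rewrite !mul0r addr0 sub0r sqrrN; apply: le_trans (iter_resolvent_dist _ m0) _.
  by rewrite ler_wpM2r// lerDl mulr_ge0 ?ler0n ?sqr_ge0.
elim: j => [|j IHj].
  rewrite !mul0r addr0 subr0 -opprB -scaleN1r ip_scale sqrrN expr1n mul1r.
  apply: le_trans (iter_resolvent_dist i.+1 l0) _.
  by rewrite ler_wpM2r// lerDl mulr_ge0 ?ler0n ?sqr_ge0.
rewrite -(ler_pM2l (addr_gt0 l0 m0)).
apply: le_trans (resolvent_kobayashi _ _ l0 m0) _.
have h1 := ler_wpM2l (ltW m0) (IHi j.+1).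
have h2 := ler_wpM2l (ltW l0) IHj.
(* The bracket of the statement solves this recursion with equality. *)
apply: le_trans (lerD h1 h2) _; rewrite -!natr1.
by rewrite le_eqVlt; apply/orP; left; apply/eqP; ring.
Qed.

Definition euler l t g := iter (Num.truncn (t / l)) (J l) g.

(** Rounding [t] and [s] down to multiples of [l] and [m] shifts the times by at most [l] and [m],
    and [i * l ^+ 2 <= t * l]. *)
Lemma euler_cauchy l m t s : 0 < l -> 0 < m -> 0 <= t -> 0 <= s ->
  sq (euler l t f - euler m s f) <=
  ((`|t - s| + l + m) ^+ 2 + t * l + s * m) * N.
Proof.
move=> l0 m0 t0 s0; apply: le_trans (iter_resolvent_cauchy _ _ l0 m0) _.
have /andP[] := truncn_itv (divr_ge0 t0 (ltW l0)).
have /andP[] := truncn_itv (divr_ge0 s0 (ltW m0)).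
move: (Num.truncn _) (Num.truncn _) => i j.
rewrite ler_pdivlMr// ltr_pdivrMr// ler_pdivlMr// ltr_pdivrMr// -!natr1 => j1 j2 i1 i2.
rewrite ler_wpM2r//; apply: lerD; first apply: lerD.
- rewrite -[leLHS]real_normK ?num_real// ler_pXn2r ?nnegrE ?addr_ge0 ?(ltW l0) ?(ltW m0)//.
  have := ler_norm (t - s); have := ler_norm (s - t); rewrite (distrC s t) => h1 h2.
  rewrite ler_norml; apply/andP; split; lra.
- by rewrite expr2 mulrA ler_pM2r.
- by rewrite expr2 mulrA ler_pM2r.
Qed.

End Orbit.

(** * The limit flow and its semigroup law *)

Definition flow t f z := lim ((fun l => euler l t f z) @ 0^'+).

Lemma euler_cvg t f z : 0 <= t -> (fun l => euler l t f z) @ 0^'+ --> flow t f z.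
Proof.
move=> t0; have [N N0 fN] := yosida_bounded f.
apply/cauchy_cvgP; apply: cauchy_exP => e e0.
(* For [l < a <= 1] the bracket of [euler_cauchy] is at most [(4 + 2 * t) * a], so the squared
   distance is at most [(K - 1) * a]; the extra 1 makes this strictly less than [e ^+ 2]. *)
pose K := deg E w z * N * (4 + 2 * t) + 1.
have K0 : 0 < K by rewrite ltr_wpDl// !mulr_ge0 ?(ltW (deg_gt0 z))//; lra.
pose a := Num.min 1 (e ^+ 2 / K).
have a0 : 0 < a by rewrite lt_min ltr01 divr_gt0// exprn_gt0.
exists (euler a t f z).
suff : \forall l \near (0 : R)^'+, ball (euler a t f z) e (euler l t f z) by [].
near=> l.
have l0 : 0 < l by near: l; exact: nbhs_right_gt.
have la : l < a by near: l; exact: nbhs_right_lt.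
rewrite /ball/= -(ltr_pXn2r (isT : (0 < 2)%N)) ?nnegrE ?(ltW e0)//.
rewrite real_normK ?num_real//.
apply: le_lt_trans (sqr_le_ip deg_gt0 (euler a t f - euler l t f) z) _.
apply: le_lt_trans (ler_wpM2l (ltW (deg_gt0 z)) (euler_cauchy fN a0 l0 t0 t0)) _.
rewrite subrr normr0 add0r.
have a1 : a <= 1 by rewrite ge_min lexx.
have aK : a * K <= e ^+ 2 by rewrite -ler_pdivlMr// ge_min lexx orbT.
have C0 : 0 <= deg E w z * N by rewrite mulr_ge0// ltW.
have Q : (a + l) ^+ 2 + t * a + t * l <= (4 + 2 * t) * a by nra.
have := ler_wpM2l C0 Q; move: aK; rewrite /K; lra.
Unshelve. all: by end_near.
Qed.

Lemma euler_seq_cvg (u : nat -> R) t f z : 0 <= t -> (forall n, 0 < u n) ->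
  u @ \oo --> 0 -> (fun n => euler (u n) t f z) @ \oo --> flow t f z.
Proof.
move=> t0 u0 uc; have /cvg_at_rightP := @euler_cvg t f z t0; apply.
by split.
Qed.

Lemma flow0 f : flow 0 f = f.
Proof.
apply: funext => z; rewrite /flow /euler; under eq_fun do rewrite mul0r truncn0.
exact: lim_cst.
Qed.

Lemma flow_lipschitz N f t s :
  (forall l, 0 < l -> ip (yosida l f) (yosida l f) <= N) -> 0 <= t -> 0 <= s ->
  ip (flow t f - flow s f) (flow t f - flow s f) <= (t - s) ^+ 2 * N.
Proof.
move=> fN t0 s0.
have id0 : (fun l : R => l) @ 0^'+ --> (0 : R).
  by apply: cvg_at_right_filter; exact: cvg_id.
have cl : (fun l => ip (euler l t f - euler l s f) (euler l t f - euler l s f))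
    @ 0^'+ --> ip (flow t f - flow s f) (flow t f - flow s f).
  by apply: cvg_ip => z; apply: cvgB; exact: euler_cvg.
have cr : (fun l => ((`|t - s| + l + l) ^+ 2 + t * l + s * l) * N)
    @ 0^'+ --> ((`|t - s| + 0 + 0) ^+ 2 + t * 0 + s * 0) * N.
  apply: cvgM (cvg_cst _); apply: cvgD; last exact: cvgM (cvg_cst _) id0.
  apply: cvgD; last exact: cvgM (cvg_cst _) id0.
  rewrite expr2; under eq_fun do rewrite expr2.
  by apply: cvgM; (do 2 (apply: cvgD => //)); exact: cvg_cst.
rewrite -(real_normK (num_real (t - s))).
rewrite (_ : `|t - s| ^+ 2 * N = ((`|t - s| + 0 + 0) ^+ 2 + t * 0 + s * 0) * N).
  apply: ler_cvg_to cl cr _; near=> l.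
  have l0 : 0 < l by near: l; exact: nbhs_right_gt.
  exact: euler_cauchy.
by rewrite !addr0 !mulr0 !addr0.
Unshelve. all: by end_near.
Qed.

(** With this step the time [s] is exactly [n.+1] steps, so integer parts cause no rounding when
    times are added. *)
Definition mesh s n : R := s / n.+1%:R.

Lemma mesh_gt0 s n : 0 < s -> 0 < mesh s n.
Proof. by move=> s0; rewrite divr_gt0. Qed.

Lemma mesh_cvg s : mesh s @ \oo --> 0.
Proof.
rewrite -[0](mulr0 s); apply: cvgM (cvg_cst _) _; exact: cvg_harmonic.
Qed.

Lemma euler_meshD s n t f : 0 < s -> 0 <= t ->
  euler (mesh s n) (t + s) f = iter n.+1 (J (mesh s n)) (euler (mesh s n) t f).
Proof.
move=> s0 t0; have d0 := mesh_gt0 n s0.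
have sd : s / mesh s n = n.+1%:R by rewrite invf_div mulrCA divff ?mulr1// gt_eqF.
have td : t / mesh s n \in Num.nneg by rewrite nnegrE divr_ge0// ltW.
by rewrite /euler mulrDl sd addrC truncnD ?natr_nat// natrK iterD.
Qed.

Lemma euler_mesh s n f : 0 < s ->
  euler (mesh s n) s f = iter n.+1 (J (mesh s n)) f.
Proof.
by move=> s0; rewrite -{2}(add0r s) euler_meshD// /euler mul0r truncn0.
Qed.

(** Along the mesh of [s], both sides are limits of the same [n.+1] resolvent steps, started from
    [euler] at time [t] and from its limit. The steps are nonexpansive and the gap between the
    starting points tends to 0. *)
Lemma flowD t s f : 0 <= t -> 0 < s -> flow (t + s) f = flow s (flow t f).
Proof.
move=> t0 s0; apply/eqP; rewrite -subr_eq0; apply/eqP; apply: (ip_le0_eq0 deg_gt0).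
pose a n := euler (mesh s n) (t + s) f - euler (mesh s n) s (flow t f).
pose b n := euler (mesh s n) t f - flow t f.
have u0 n := mesh_gt0 n s0.
have ca : (fun n => ip (a n) (a n)) @ \oo --> ip (flow (t + s) f - flow s (flow t f))
    (flow (t + s) f - flow s (flow t f)).
  apply: cvg_ip => z; apply: cvgB; apply: euler_seq_cvg => //;
    rewrite ?addr_ge0 ?(ltW s0)//; exact: mesh_cvg.
have cb : (fun n => ip (b n) (b n)) @ \oo --> ip (0 : V -> R) 0.
  apply: cvg_ip => z; rewrite -[(0 : V -> R) z](subrr (flow t f z)); apply: cvgB;
    (try exact: cvg_cst); apply: euler_seq_cvg => //; exact: mesh_cvg.
rewrite ip0l in cb.
apply: ler_cvg_to ca cb _; near=> n.
by rewrite /a euler_meshD// euler_mesh//; exact: iter_resolvent_nonexpansive.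
Unshelve. all: by end_near.
Qed.

(** * Short-time increments of the flow compared with Yosida approximations *)

Section RightDerivative.
Variables (N : R) (f : V -> R).
Hypothesis N_bound : forall l, 0 < l -> ip (yosida l f) (yosida l f) <= N.

Let N_ge0 : 0 <= N.
Proof. exact: le_trans (ip_ge0 deg_gt0 _) (N_bound ltr01). Qed.

(* Monotonicity between the orbit points and [J l f], summed along the orbit. *)
Lemma iter_resolvent_ip_yosida l m n k : 0 < l -> 0 < m -> (k <= n)%N ->
  k%:R * m * (l * ip (yosida l f) (yosida l f) - 3 * (n%:R * m) * N) <=
  l * ip (yosida l f) (f - iter k (J m) f).
Proof.
move=> l0 m0; elim: k => [|k IH kn].
  by rewrite /= subrr ip0r !mul0r mulr0.
have {}IH := IH (ltnW kn).
have nm : 0 < n%:R * m by rewrite mulr_gt0// ltr0n (leq_trans _ kn).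
set x := iter k (J m) f in IH *; set y := J m x.
have mono := A_mono (A_resolvent x m0) (A_resolvent f l0).
have yk := iter_resolvent_dist N_bound k.+1 m0.
have st := iter_resolvent_step N_bound k m0.
rewrite iterS -/x -/y in yk st *; rewrite -/y in mono.
have ey : x - y = m *: yosida m x by rewrite yosidaE.
have ec : f - y = (f - x) + m *: yosida m x by rewrite -ey addrA subrK.
rewrite ey ip_scale ler_pM2l ?exprn_gt0// in st.
have pN := N_bound l0.
rewrite (_ : y - J l f = l *: yosida l f - (f - y)) in mono; last first.
  by rewrite -yosidaE// opprB [RHS]addrC addrA subrK.
have {}yk : ip (f - y) (f - y) <= (n%:R * m) ^+ 2 * N.
  apply: le_trans yk _.
  rewrite ler_wpM2r// ler_pXn2r ?nnegrE ?mulr_ge0 ?(ltW m0)//.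
  by rewrite ler_pM2r// ler_nat.
have -> : ip (yosida l f) (f - y) =
    ip (yosida l f) (f - x) + m * ip (yosida l f) (yosida m x).
  by rewrite ec ipDr ipZr.
(* The weight fits the bound [(n%:R * m) ^+ 2 * N] on the square of [f - y]. Since the difference of
   the Yosida values has square at most [4 * N], half the sum is at most [5/2 * (n%:R * m) * N],
   which the constant 3 rounds up. *)
have := @ip_young _ _ _ _ deg_gt0 (n%:R * m)^-1 (f - y) (yosida l f - yosida m x).
rewrite invr_gt0 invrK => /(_ nm) yng.
have yk' : (n%:R * m)^-1 * ip (f - y) (f - y) <= n%:R * m * N.
  by rewrite ler_pdivrMl// mulrA -expr2.
move: (yosida l f) (yosida m x) (f - y) (f - x) yng yk' pN st mono IH => p q a b.
have := ip_young1 deg_gt0 p (-1 *: q); rewrite ip_scale sqrrN expr1n mul1r ipZr.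
rewrite !ipE (ipC _ _ q p).
move: ((n%:R * m)^-1 * ip a a) => aa.
move: (n%:R * m) nm => s s0 hpq yng yk' pN st mono IH.
have hN : s * (ip p p - ip p q - (ip p q - ip q q)) <= s * (4 * N).
  by rewrite ler_pM2l//; lra.
have h : l * ip p p - 3 * s * N <= l * ip p q.
  by have := mulr_ge0 (ltW s0) N_ge0; lra.
have := ler_wpM2l (ltW m0) h.
rewrite -natr1; lra.
Qed.

(** For the mesh iterates, expand the square: the difference quotient has square at most [N], and
    its inner product with [p = yosida l f] is at least [ip p p - 3 * s * N / l]. The bound passes
    to the limit. *)
Lemma flow_increment_yosida l s : 0 < l -> 0 < s ->
  ip (s^-1 *: (f - flow s f) - yosida l f) (s^-1 *: (f - flow s f) - yosida l f)
  <= N - ip (yosida l f) (yosida l f) + 6 * s * N / l.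
Proof.
move=> l0 s0; pose a n := s^-1 *: (f - euler (mesh s n) s f) - yosida l f.
have ca : (fun n => ip (a n) (a n)) @ \oo -->
    ip (s^-1 *: (f - flow s f) - yosida l f) (s^-1 *: (f - flow s f) - yosida l f).
  apply: cvg_ip => z; (apply: cvgB; last exact: cvg_cst); apply: cvgM (cvg_cst _) _;
    (apply: cvgB; first exact: cvg_cst); apply: euler_seq_cvg (ltW s0) _ _ => // [n|];
    do ?exact: mesh_gt0; exact: mesh_cvg.
apply: (ler_cvg_to ca (cvg_cst _)); near=> n.
rewrite /a euler_mesh//; have d0 := mesh_gt0 n s0.
have nd : n.+1%:R * mesh s n = s by rewrite mulrCA divff ?mulr1.
have := iter_resolvent_dist N_bound n.+1 d0.
have := iter_resolvent_ip_yosida l0 d0 (leqnn n.+1).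
rewrite nd; move: (f - _) (yosida l f) => x p h1 h2.
have {}h1 : ip p p - 3 * s * N / l <= s^-1 * ip p x.
  rewrite -(ler_pM2l s0) mulrA divff ?gt_eqF// mul1r -(ler_pM2l l0).
  apply: le_trans h1; rewrite le_eqVlt; apply/orP; left; apply/eqP; field.
  by rewrite gt_eqF.
have {}h2 : s^-1 ^+ 2 * ip x x <= N.
  by rewrite exprVn ler_pdivrMl// exprn_gt0.
rewrite !ipE (ipC _ _ x p).
rewrite (_ : 6 * s * N / l = 2 * (3 * s * N / l)); last by ring.
by move: h1 h2; rewrite expr2 -mulrA; lra.
Unshelve. all: by end_near.
Qed.

End RightDerivative.

(** Take [N] to be the supremum of the squared norms: by [yosida_le] a nearly optimal [l1] serves
    every smaller [l]. The defect in [flow_increment_yosida] is then small at whichever small [l]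
    the curvature bound provides. *)
Lemma yosida_sup_attained f eta : 0 < eta -> exists N l1, [/\ 0 < l1,
  forall l, 0 < l -> ip (yosida l f) (yosida l f) <= N &
  forall l, 0 < l -> l <= l1 -> N - eta <= ip (yosida l f) (yosida l f)].
Proof.
move=> e0; have [N0 _ fN] := yosida_bounded f.
pose S := [set ip (yosida l f) (yosida l f) | l in [set l | 0 < l]].
have Ssup : has_sup S.
  split; first by exists (ip (yosida 1 f) (yosida 1 f)), 1 => //=.
  by exists N0 => _ [l l0 <-]; exact: fN.
have [_ [l1 l10 <-] hl1] := sup_adherent e0 Ssup.
exists (sup S), l1; split => //.
  by move=> l l0; apply: sup_upper_bound => //; exists l.
move=> l l0 ll1; apply: le_trans (ltW hl1) _; exact: yosida_le.
Qed.

(** A single good [l] below [l1] suffices: it is fixed first, and [s] is made small relative to it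
    afterwards. *)
Lemma flow_right_derivative f D K eps : 0 < eps ->
  (forall a, 0 < a -> exists l, [/\ 0 < l, l < a & K <= ip (yosida l f) D]) ->
  exists2 a, 0 < a & forall s, 0 < s -> s < a ->
    ip (flow s f) D <= ip f D - s * (K - eps).
Proof.
move=> e0 hK; pose B := ip D D + 1.
have B0 : 0 < B by rewrite ltr_wpDl ?ip_ge0.
(* One [eta] pays for the norm defect and one for [6 * s * N / l], in total [eps ^+ 2 / B]. Young's
   inequality with weight [B / eps] turns this into an error of at most [eps] against [D]. *)
pose eta := eps ^+ 2 / B / 2.
have eta0 : 0 < eta by rewrite !divr_gt0 ?exprn_gt0.
have [N [l1 [l10 fN Nl]]] := yosida_sup_attained f eta0.
have N0 : 0 <= N by exact: le_trans (ip_ge0 deg_gt0 _) (fN _ ltr01).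
have [l [l0 ll1 Kl]] := hK _ l10.
have {}Nl := Nl _ l0 (ltW ll1).
have N1 : 0 < 6 * N + 1 by lra.
exists (eta * l / (6 * N + 1)); first by rewrite divr_gt0// mulr_gt0.
move=> s s0; rewrite ltr_pdivlMr// => sl; have inc := flow_increment_yosida fN l0 s0.
have h6 : 6 * s * N / l <= eta by rewrite ler_pdivrMr//; lra.
have {h6 inc} := le_trans inc (lerD (lexx _) h6); set wv := s^-1 *: (f - flow s f).
move=> inc; have {inc} : ip (wv - yosida l f) (wv - yosida l f) <= eps ^+ 2 / B.
  by apply: le_trans inc _; move: Nl; rewrite /eta; lra.
rewrite -(ler_pM2l (_ : 0 < B / eps)) ?divr_gt0//.
rewrite (_ : B / eps * (eps ^+ 2 / B) = eps); last by field; rewrite !gt_eqF.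
move=> inc; have := @ip_young _ _ _ _ deg_gt0 (B / eps) (wv - yosida l f) (-1 *: D).
rewrite divr_gt0// => /(_ isT).
rewrite ip_scale sqrrN expr1n mul1r invf_div => yng.
have eB : eps / B * ip D D <= eps.
  by rewrite mulrAC ler_pdivrMr// ler_pM2l// /B lerDl.
have wK : K - eps <= ip wv D.
  move: yng inc; set z := ip (wv - _) (wv - _); rewrite ipZr ipBl; lra.
have -> : flow s f = f - s *: wv.
  by rewrite scalerA divff ?gt_eqF// scale1r subKr.
by rewrite ipBl ipZl lerD2l lerN2 ler_pM2l.
Qed.

End MonotoneOperator.

(** * Existence of the resolvent *)

Section NonnegativeLeastSquares.
Variables (R : realType) (I K : finType).
Variables (om : K -> R) (M : K -> I -> R) (b : K -> R) (alpha : R).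
Implicit Types c : I -> R.

Let residual c k := \sum_i M k i * c i - b k.
Let cost c := \sum_k om k * residual c k ^+ 2.

Hypothesis om_ge0 : forall k, 0 <= om k.
Hypothesis alpha_gt0 : 0 < alpha.
Hypothesis coercive : forall c i, (forall j, 0 <= c j) -> alpha * c i ^+ 2 <= cost c.

Let cost_cvg (T : Type) (F : set_system T) (FF : Filter F) (u : T -> I -> R) c :
  (forall i, u t i @[t --> F] --> c i) -> cost (u t) @[t --> F] --> cost c.
Proof.
move=> uc; apply: (cvg_sumr FF) => k.
have rc : residual (u t) k @[t --> F] --> residual c k.
  apply: cvgB; last exact: cvg_cst.
  by apply: (cvg_sumr FF) => i; apply: cvgM; [exact: cvg_cst|exact: uc].
by apply: cvgM; [exact: cvg_cst|exact: cvgM].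
Qed.

Lemma nnls_minimizer : exists c,
  (forall i, 0 <= c i) /\ forall c', (forall i, 0 <= c' i) -> cost c <= cost c'.
Proof.
have cost_ge0 c : 0 <= cost c by apply: sumr_ge0 => k _; rewrite mulr_ge0 ?sqr_ge0.
(* A coordinate above [B >= 1] forces the cost above [alpha * B = alpha + cost 0] by coercivity, so
   a minimiser over the box [[0, B]] is global. *)
pose B := 1 + cost (fun=> 0) / alpha.
have B1 : 1 <= B by rewrite lerDl divr_ge0// ltW.
pose coef (v : 'rV[R]_#|I|) i := v ord0 (enum_rank i).
pose vec c : 'rV[R]_#|I| := \row_j c (enum_val j).
have vecK c : coef (vec c) = c by apply: funext => i; rewrite /coef mxE enum_rankK.
pose S := [set v : 'rV[R]_#|I| | forall j, `[0, B]%classic (v ord0 j)].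
have vecS c : (forall i, 0 <= c i) -> (forall i, c i <= B) -> S (vec c).
  by move=> c0 cB j; rewrite /= mxE in_itv/= c0 cB.
have S0 : S !=set0 by exists (vec (fun=> 0)); apply: vecS => // i; lra.
have cS : compact S.
  exact: (@rV_compact R #|I| (fun=> `[0, B]%classic) (fun _ => @segment_compact _ _ _)).
have cost_cont : continuous (cost \o coef).
  by move=> v; apply: (cost_cvg (nbhs_filter v)) => i; exact: coord_continuous.
have [v vS vmin] := compact_EVT_min S0 cS (continuous_subspaceT cost_cont).
rewrite inE in vS.
have cv0 i : 0 <= coef v i by have := vS (enum_rank i); rewrite /= in_itv/= => /andP[].
exists (coef v); split => // c c0.
have [cB|/existsNP[i /negP]] := pselect (forall i, c i <= B).
  by rewrite -(vecK c); apply: vmin; rewrite inE; exact: vecS.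
rewrite -ltNge => Bc.
have h0 : cost (coef v) <= cost (fun=> 0).
  by rewrite -(vecK (fun=> 0)); apply: vmin; rewrite inE; apply: vecS => // j; lra.
apply: le_trans h0 _; apply: le_trans (coercive i c0).
have aB : alpha * B = alpha + cost (fun=> 0).
  by rewrite /B mulrDr mulr1 mulrCA divff ?mulr1 ?gt_eqF.
have BB : alpha * B <= alpha * c i ^+ 2 by rewrite ler_pM2l//; nra.
by apply: le_trans BB; rewrite aB lerDr ltW.
Qed.

Let slope c i := \sum_k om k * M k i * residual c k.

(** [slope] is half the partial derivative, and the cost is exactly quadratic along each coordinate.
    A negative slope could be exploited by increasing [c i], a positive one by decreasing [c i] when
    there is room; [Q i + 1] in the step size avoids division by zero. *)
Lemma nnls_kkt : exists c, [/\ forall i, 0 <= c i,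
  forall i, 0 <= slope c i & forall i, 0 < c i -> slope c i = 0].
Proof.
have [c [c0 cmin]] := nnls_minimizer; exists c.
pose Q i := \sum_k om k * M k i ^+ 2.
have Q0 i : 0 <= Q i by apply: sumr_ge0 => k _; rewrite mulr_ge0 ?sqr_ge0.
have pert i h : - c i <= h -> 0 <= h * (2 * slope c i + h * Q i).
  move=> hc; pose c' j := c j + h * (j == i)%:R.
  have c'0 j : 0 <= c' j.
    rewrite /c'; case: eqVneq => [->|_]; rewrite ?mulr1 ?mulr0 ?addr0//; lra.
  have rE k : residual c' k = residual c k + h * M k i.
    rewrite /residual /c'; under eq_bigr do rewrite mulrDr.
    rewrite big_split/= [X in _ + X - _](bigD1 i)//= eqxx mulr1.
    rewrite [X in _ + (_ + X)]big1 => [|j /negPf ->]; last by rewrite !mulr0.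
    by ring.
  suff <- : cost c' - cost c = h * (2 * slope c i + h * Q i).
    by rewrite subr_ge0; exact: cmin.
  rewrite -sumrB mulr_sumr [h * \sum_k _]mulr_sumr -big_split mulr_sumr.
  by apply: eq_bigr => k _ /=; rewrite rE; ring.
have sl0 i : 0 <= slope c i.
  rewrite leNgt; apply/negP => sn.
  have Qp : 0 < Q i + 1 by rewrite ltr_wpDl.
  have h0 : 0 < - slope c i / (Q i + 1) by rewrite divr_gt0// oppr_gt0.
  have := pert i (- slope c i / (Q i + 1)); rewrite pmulr_rge0//.
  have -> // : - c i <= - slope c i / (Q i + 1).
    by apply: le_trans (ltW h0); rewrite oppr_le0.
  move=> /(_ isT); rewrite mulrAC.
  have : - slope c i * Q i / (Q i + 1) <= - slope c i.
    by rewrite ler_pdivrMr//; nra.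
  lra.
split=> // i ci; apply/eqP; rewrite eq_le sl0 andbT leNgt; apply/negP => sp.
have Qp : 0 < Q i + 1 by rewrite ltr_wpDl.
pose a := Num.min (c i) (slope c i / (Q i + 1)).
have a0 : 0 < a by rewrite lt_min ci divr_gt0.
have ac : - c i <= - a by rewrite lerN2 ge_min lexx.
have aQ : a * (Q i + 1) <= slope c i by rewrite -ler_pdivlMr// ge_min lexx orbT.
have := pert i (- a) ac; rewrite mulNr oppr_ge0 pmulr_rle0//; lra.
Qed.

End NonnegativeLeastSquares.

(** * The normalized Laplacian: monotonicity, resolvent, scaling *)

Section Laplacian.
Variables (R : realType) (V : finType) (E : {set {set V}}) (w : {set V} -> R).
Hypothesis wf : wf_hypergraph E w.
Hypothesis deg_gt0 : forall x, 0 < deg E w x.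
Implicit Types (f g h b : V -> R) (e : {set V}) (l : R).
Local Notation ip := (ip E w).

Let w_gt0 e : e \in E -> 0 < w e. Proof. by case: wf => _; exact. Qed.
Let card_gt0 e : e \in E -> (0 < #|e|)%N. Proof. by case: wf => + _; exact. Qed.

Lemma dotp_delta x f : dotp (delta R x) f = f x.
Proof.
rewrite /dotp (bigD1 x)//= /delta eqxx mul1r big1 ?addr0// => y /negPf ->.
by rewrite mul0r.
Qed.

Lemma dotp_conv (c : V * V -> R) f :
  dotp (fun z => \sum_p c p * (delta R p.1 z - delta R p.2 z)) f =
  \sum_p c p * (f p.1 - f p.2).
Proof.
rewrite /dotp; under eq_bigr do rewrite mulr_suml.
rewrite exchange_big/=; apply: eq_bigr => p _.
rewrite -(dotp_delta p.1 f) -(dotp_delta p.2 f) /dotp -sumrB mulr_sumr.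
by apply: eq_bigr => z _; ring.
Qed.

Lemma dotp_scale b k f : dotp b (fun z => k * f z) = k * dotp b f.
Proof. by rewrite /dotp mulr_sumr; apply: eq_bigr => z _; ring. Qed.

Lemma Bset_dotp_le e f b m : (forall x y, x \in e -> y \in e -> f x - f y <= m) ->
  Bset e b -> dotp b f <= m.
Proof.
move=> fm [c [c0 ce c1 ->]]; rewrite dotp_conv -[leRHS]mul1r -c1 mulr_suml.
apply: ler_sum => p _; have [/andP[? ?]|/ce ->] := boolP ((p.1 \in e) && (p.2 \in e)).
  by rewrite ler_wpM2l// fm.
by rewrite !mul0r.
Qed.

Lemma Bset_delta e x y : x \in e -> y \in e ->
  Bset e (fun z => delta R x z - delta R y z).
Proof.
move=> xe ye; exists (fun p => (p == (x, y))%:R); split=> //.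
- by move=> p; case: eqVneq => // -> /=; rewrite xe ye.
- by rewrite (bigD1 (x, y))//= eqxx big1 ?addr0// => p /negPf ->.
- apply: funext => z; rewrite (bigD1 (x, y))//= eqxx mul1r big1 ?addr0//.
  by move=> p /negPf ->; rewrite mul0r.
Qed.

Lemma dotp_deltaB x y f : dotp (fun z => delta R x z - delta R y z) f = f x - f y.
Proof.
rewrite -(dotp_delta x f) -(dotp_delta y f) /dotp -sumrB.
by apply: eq_bigr => z _; rewrite mulrBl.
Qed.

Lemma argmaxB_nonempty e f : (0 < #|e|)%N -> argmaxB e f !=set0.
Proof.
move=> /card_gt0P[x0 x0e].
case: (@Order.TotalTheory.arg_maxP _ _ _ x0 (mem e) f x0e) => x xe xm.
case: (@Order.TotalTheory.arg_minP _ _ _ x0 (mem e) f x0e) => y ye ym.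
exists (fun z => delta R x z - delta R y z); split; first exact: Bset_delta.
move=> b; rewrite dotp_deltaB; apply: Bset_dotp_le => u v ue ve.
by apply: lerB; [exact: xm|exact: ym].
Qed.

Lemma argmaxB_ge0 e f b : (0 < #|e|)%N -> argmaxB e f b -> 0 <= dotp b f.
Proof.
move=> /card_gt0P[x xe] [_ /(_ _ (Bset_delta xe xe))].
by rewrite dotp_deltaB subrr.
Qed.

Lemma argmaxB_scale e f b k : 0 < k -> argmaxB e f b -> argmaxB e (fun z => k * f z) b.
Proof.
by move=> k0 [Bb bm]; split=> // b' /bm; rewrite !dotp_scale ler_pM2l.
Qed.

Lemma argmaxB_choice f :
  exists bb : {set V} -> V -> R, forall e, e \in E -> argmaxB e f (bb e).
Proof.
have H e : exists b, e \in E -> argmaxB e f b; last first.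
  by have [bb h] := boolp.choice H; exists bb.
have [eE|_] := boolP (e \in E); last by exists (fun=> 0).
by have [b bm] := argmaxB_nonempty f (card_gt0 eE); exists b.
Qed.

Lemma nLap_nonempty f : nLap E w f !=set0.
Proof. by have [bb bbm] := argmaxB_choice (fun z => f z / deg E w z); eexists; exists bb. Qed.

Lemma ip_Lap (bb : {set V} -> V -> R) (a : {set V} -> R) g :
  ip g (fun z => \sum_(e in E) w e * bb e z * a e) =
  \sum_(e in E) w e * a e * dotp (bb e) (fun z => g z / deg E w z).
Proof.
rewrite /Defs.ip; under eq_bigr do rewrite mulr_sumr mulr_suml.
rewrite exchange_big/=; apply: eq_bigr => e _; rewrite /dotp mulr_sumr.
by apply: eq_bigr => z _; ring.
Qed.

Lemma nLap_mono g h u v : nLap E w g u -> nLap E w h v -> 0 <= ip (g - h) (u - v).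
Proof.
move=> [bb [bm ->]] [cc [cm ->]]; rewrite !ipE !ip_Lap.
set gd := fun z => g z / deg E w z; set hd := fun z => h z / deg E w z.
rewrite -!sumrB; apply: sumr_ge0 => e eE.
have [bB b_max] := bm e eE; have [cB c_max] := cm e eE.
have a0 := argmaxB_ge0 (card_gt0 eE) (bm e eE).
have a'0 := argmaxB_ge0 (card_gt0 eE) (cm e eE).
have h1 := b_max _ cB; have h2 := c_max _ bB; have we := w_gt0 eE.
rewrite -/gd -/hd in a0 a'0 h1 h2 *.
set a := dotp (bb e) gd in a0 h1 *; set a' := dotp (cc e) hd in a'0 h2 *.
set p := dotp (bb e) hd in h2 *; set q := dotp (cc e) gd in h1 *.
(* Each group is nonnegative: [p <= a'] and [q <= a] because [cc e] and [bb e] are maximisers for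
   their own functions. *)
have -> : w e * a * a - w e * a' * q - (w e * a * p - w e * a' * a') =
  w e * ((a - a') ^+ 2 + a * (a' - p) + a' * (a - q)) by ring.
by rewrite mulr_ge0 ?(ltW we)// !addr_ge0 ?sqr_ge0// mulr_ge0// subr_ge0.
Qed.

Lemma nLap_scale k g u : 0 < k -> nLap E w g u -> nLap E w (k *: g) (k *: u).
Proof.
move=> k0 [bb [bm ->]]; exists bb.
have -> : (fun z => (k *: g) z / deg E w z) = (fun z => k * (g z / deg E w z)).
  by apply: funext => z; rewrite mulrA.
split; first by move=> e eE; apply: argmaxB_scale => //; exact: bm.
apply: funext => z; transitivity (k * \sum_(e in E) w e * bb e z *
  dotp (bb e) (fun z => g z / deg E w z)); first by [].
by rewrite mulr_sumr; apply: eq_bigr => e _; rewrite dotp_scale; ring.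
Qed.

Lemma nLap_deg k : nLap E w (fun z => k * deg E w z) 0.
Proof.
have -> : 0 = (fun z => \sum_(e in E) w e * (0 : V -> R) z * 0) :> (V -> R).
  by apply: funext => z; rewrite big1// => e _; rewrite mulr0.
have [bb bm] := argmaxB_choice (fun z => k * deg E w z / deg E w z).
exists bb; split=> //; apply: funext => z; apply: eq_bigr => e eE.
suff -> : dotp (bb e) (fun z => k * deg E w z / deg E w z) = 0 by rewrite !mulr0.
apply/eqP; rewrite eq_le (argmaxB_ge0 (card_gt0 eE) (bm e eE)) andbT.
apply: Bset_dotp_le (bm e eE).1 => x y _ _.
by rewrite !mulfK ?gt_eqF// subrr.
Qed.

(* The resolvent equation is dual to a nonnegative least squares problem: the
   unknowns [c (e, p)] are the masses put on the generators [delta p.1 - delta p.2]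
   of the cone over [B_e], and the KKT conditions say that, after normalisation,
   they form a maximiser over [B_e].  Junk indices get the zero generator. *)
Lemma resolvent_exists l f : 0 < l ->
  exists g u, nLap E w g u /\ f = (fun z => g z + l * u z).
Proof.
move=> l0.
(* The default 1 outside [E] keeps all weights positive, hence also [alpha], a minimum over all
   subsets of [V]. *)
pose W e := if e \in E then w e else 1.
have W0 e : 0 < W e by rewrite /W; case: ifPn => // /w_gt0.
pose valid (i : {set V} * (V * V)) := [&& i.1 \in E, i.2.1 \in i.1 & i.2.2 \in i.1].
pose D i z := if valid i then delta R i.2.1 z - delta R i.2.2 z else 0.
pose om (k : V + {set V}) := match k with inl z => (deg E w z)^-1 | inr e => l * W e end.
pose M (k : V + {set V}) (i : {set V} * (V * V)) : R :=
  match k with inl z => l * W i.1 * D i z | inr e => (i.1 == e)%:R end.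
pose b (k : V + {set V}) := match k with inl z => f z | inr _ => 0 end.
have om0 k : 0 <= om k.
  by case: k => [z|e] /=; rewrite ?invr_ge0 ?mulr_ge0 ?(ltW l0) ?(ltW (W0 _)) ?(ltW (deg_gt0 _)).
pose a (c : {set V} * (V * V) -> R) e : R := \sum_i (i.1 == e)%:R * c i.
have age c e p : (forall i, 0 <= c i) -> c (e, p) <= a c e.
  move=> c0; rewrite /a (bigD1 (e, p))//= eqxx mul1r lerDl.
  by apply: sumr_ge0 => i _; rewrite mulr_ge0.
pose alpha := l * \big[Num.min/1]_e W e.
have alpha0 : 0 < alpha.
  by rewrite mulr_gt0//; elim/big_ind : _ => // x y x0 y0; rewrite lt_min x0 y0.
(* The row [inr i.1] alone gives coercivity: its residual is the total mass on that set, which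
   dominates [c i] since all masses are nonnegative. *)
have coer c i : (forall j, 0 <= c j) ->
    alpha * c i ^+ 2 <= \sum_k om k * (\sum_i M k i * c i - b k) ^+ 2.
  move=> c0; rewrite big_sumType/= (bigD1 i.1)//= [leRHS]addrCA.
  rewrite -[leLHS]addr0; apply: lerD; last first.
    by apply: addr_ge0; apply: sumr_ge0 => k _;
      rewrite mulr_ge0 ?sqr_ge0 ?(om0 (inl _)) ?(om0 (inr _)).
  rewrite subr0 -/(a c i.1) /alpha -!mulrA ler_pM2l//.
  apply: ler_pM => //; rewrite ?sqr_ge0//.
  - by apply/ltW; elim/big_ind : _ => // x y x0 y0; rewrite lt_min x0 y0.
  - exact: bigmin_le.
  - by rewrite ler_pXn2r ?nnegrE// ?(le_trans (c0 i))//; case: (i) => e p; exact: age.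
have [c [c0 sl sl0]] := nnls_kkt om0 alpha0 coer.
pose g z := f z - \sum_i l * W i.1 * D i z * c i.
pose gd z := g z / deg E w z.
pose ac := a c.
(* After this factorisation the KKT conditions read: [dotp (D i) gd] is at most the mass [ac i.1],
   with equality where [c i > 0]. *)
have slE i : \sum_k om k * M k i * (\sum_j M k j * c j - b k) =
    l * W i.1 * (ac i.1 - dotp (D i) gd).
  rewrite big_sumType/= mulrBr addrC; congr (_ + _).
    rewrite (bigD1 i.1)//= eqxx mulr1 [X in _ + X]big1 ?addr0; last first.
      by move=> e ne; rewrite (eq_sym i.1) (negPf ne) mulr0 mul0r.
    by rewrite subr0.
  rewrite /dotp mulr_sumr -sumrN; apply: eq_bigr => z _.
  by rewrite /gd /g; ring.
have {}sl i : dotp (D i) gd <= ac i.1.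
  by have := sl i; rewrite slE pmulr_rge0 ?mulr_gt0// subr_ge0.
have {}sl0 i : 0 < c i -> dotp (D i) gd = ac i.1.
  move=> /sl0; rewrite slE => /eqP; rewrite mulf_eq0 gt_eqF ?mulr_gt0//=.
  by rewrite subr_eq0 => /eqP.
have D0 : dotp (fun=> 0) gd = 0 by rewrite /dotp big1// => z _; rewrite mul0r.
have cinv i : ~~ valid i -> c i = 0.
  move=> iv; apply/eqP; rewrite eq_le c0 andbT leNgt; apply/negP => ci.
  have := sl0 i ci; rewrite /D (negPf iv) D0 => a0.
  by have := age c i.1 i.2 c0; rewrite -surjective_pairing -/(ac _) -a0 leNgt ci.
have acE e : ac e = \sum_p c (e, p).
  rewrite /ac /a (eq_bigr (fun i => (i.1 == e)%:R * c (i.1, i.2))); last by case.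
  rewrite -(pair_bigA _ (fun e' p => (e' == e)%:R * c (e', p)))/= (bigD1 e)//= eqxx.
  rewrite [X in _ + X]big1 ?addr0; first by apply: eq_bigr => p _; rewrite mul1r.
  by move=> e' /negPf ->; rewrite big1// => p _; rewrite mul0r.
have ac0 e : 0 <= ac e by rewrite acE; apply: sumr_ge0.
have gdle e x y : e \in E -> x \in e -> y \in e -> gd x - gd y <= ac e.
  move=> eE xe ye; have := sl (e, (x, y)).
  by rewrite /D /valid/= eE xe ye/= dotp_deltaB.
have [bb0 bm0] := argmaxB_choice gd.
(* A zero mass cannot be normalised, but then the maximum over [B_e] is 0 and any maximiser
   contributes nothing. *)
pose bb e := if 0 < ac e then
  fun z => \sum_p (c (e, p) / ac e) * (delta R p.1 z - delta R p.2 z) else bb0 e.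
have key e : e \in E -> argmaxB e gd (bb e) /\
    forall z, bb e z * dotp (bb e) gd = \sum_p c (e, p) * D (e, p) z.
  move=> eE; have cD z p : c (e, p) * D (e, p) z =
      c (e, p) * (delta R p.1 z - delta R p.2 z).
    have [v|/cinv ->] := boolP (valid (e, p)); last by rewrite !mul0r.
    by rewrite /D v.
  rewrite /bb; case: ifPn => [acp|].
    have dE : dotp (fun z => \sum_p (c (e, p) / ac e) * (delta R p.1 z - delta R p.2 z)) gd = ac e.
      rewrite dotp_conv; under eq_bigr do rewrite mulrAC.
      rewrite -mulr_suml -[RHS](mulfK (lt0r_neq0 acp)); congr (_ / _).
      rewrite {2}acE mulr_sumr; apply: eq_bigr => p _.
      have [v|/cinv ->] := boolP (valid (e, p)); last by rewrite mulr0 mul0r.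
      have := c0 (e, p); rewrite le_eqVlt => /predU1P[<-|/sl0]; first by rewrite mulr0 mul0r.
      by rewrite /D v/= dotp_deltaB => ->; rewrite mulrC.
    split; last first.
      move=> z; rewrite dE mulr_suml; apply: eq_bigr => p _; rewrite cD.
      by field; rewrite gt_eqF.
    split; last by rewrite dE => b' ; apply: Bset_dotp_le => x y; exact: gdle.
    exists (fun p => c (e, p) / ac e); split=> //.
    - by move=> p; rewrite divr_ge0.
    - by move=> p pe; rewrite cinv ?mul0r// /valid/= eE.
    - by rewrite -mulr_suml -acE divff// gt_eqF.
  rewrite -leNgt => acn; split; first exact: bm0.
  have ae0 : ac e = 0 by apply/eqP; rewrite eq_le acn ac0.
  move=> z; have -> : dotp (bb0 e) gd = 0.
    apply/eqP; rewrite eq_le (argmaxB_ge0 (card_gt0 eE) (bm0 e eE)) andbT -ae0.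
    by apply: Bset_dotp_le (bm0 e eE).1 => x y; exact: gdle.
  rewrite mulr0 big1// => p _.
  have -> : c (e, p) = 0; last by rewrite mul0r.
  by apply/eqP; rewrite eq_le c0 andbT -ae0; exact: age.
exists g, (fun z => \sum_(e in E) w e * bb e z * dotp (bb e) gd); split.
  by exists bb; split=> // e /key[].
apply: funext => z; rewrite /g -addrA -[LHS]addr0; congr (_ + _).
apply/esym/eqP; rewrite addrC subr_eq0; apply/eqP; rewrite mulr_sumr.
rewrite (eq_bigr (fun i => l * W i.1 * (c (i.1, i.2) * D (i.1, i.2) z))); last first.
  by case=> e p _; ring.
rewrite -(pair_bigA _ (fun e p => l * W e * (c (e, p) * D (e, p) z)))/=.
rewrite [RHS](bigID (mem E))/= [X in _ + X]big1 ?addr0; last first.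
  move=> e eE; rewrite big1// => p _; rewrite cinv ?mul0r ?mulr0//.
  by rewrite /valid/= (negPf eE).
apply: eq_bigr => e eE; rewrite -mulr_sumr -(key e eE).2 /W eE; ring.
Qed.

Local Notation J := (resolvent E w).

(** Existence rules out the default value of [xget] in [resolvent]. *)
Lemma nLap_resolvent l f : 0 < l -> nLap E w (J l f) (yosida J l f).
Proof.
move=> l0; have [g [u [gu fE]]] := resolvent_exists f l0.
have := @xgetPex _ (fun=> 0) [set g | exists u, nLap E w g u /\ f = fun z => g z + l * u z].
case; first by exists g, u.
rewrite -/(J l f) => v [Lv fv].
suff -> : yosida J l f = v by [].
apply: funext => z; rewrite -[LHS]/(l^-1 * (f z - J l f z)).
by rewrite {1}(congr1 (@^~ z) fv) addrC addKr mulKf// gt_eqF.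
Qed.

Lemma resolvent_unique l f g u : 0 < l -> nLap E w g u -> f = g + l *: u -> J l f = g.
Proof.
move=> l0 gu fE; have := nLap_mono (nLap_resolvent f l0) gu.
have -> : yosida J l f - u = - l^-1 *: (J l f - g).
  apply: (scalerI (lt0r_neq0 l0)).
  rewrite scalerBr -yosidaE// scalerA mulrN divff ?gt_eqF// scaleN1r opprB.
  by move: (J l f) => X; rewrite fE addrAC addrK.
rewrite ipZr mulNr oppr_ge0 pmulr_rle0 ?invr_gt0//.
by move=> /(ip_le0_eq0 deg_gt0)/eqP; rewrite subr_eq0 => /eqP.
Qed.

Lemma resolvent_scale l k f : 0 < l -> 0 < k -> J l (k *: f) = k *: J l f.
Proof.
move=> l0 k0; apply: (resolvent_unique l0 (nLap_scale k0 (nLap_resolvent f l0))).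
by rewrite scalerA mulrC -scalerA -scalerDr -yosidaE// addrC subrK.
Qed.

Lemma resolvent_deg l k : 0 < l -> J l (fun z => k * deg E w z) = (fun z => k * deg E w z).
Proof.
by move=> l0; apply: (resolvent_unique l0 (nLap_deg k)); rewrite scaler0 addr0.
Qed.

End Laplacian.

(** * The gradient estimate *)

(** At the infimum of the failure set [P] holds by closedness from the left, and openness to the
    right then keeps failures away from it. *)
Lemma real_induction (R : realType) (P : R -> Prop) : P 0 ->
  (forall t, 0 <= t -> P t -> exists2 a, 0 < a & forall s, 0 < s -> s < a -> P (t + s)) ->
  (forall t, 0 < t -> (forall s, 0 <= s -> s < t -> P s) -> P t) ->
  forall t, 0 <= t -> P t.
Proof.
move=> P0 right left t t0; apply: contrapT => nPt.
pose S := [set s | 0 <= s /\ ~ P s].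
have Sinf : has_inf S by split; [exists t|exists 0 => s []].
have m0 : 0 <= inf S by apply: lb_le_inf Sinf.1 _ => s [].
have below s : 0 <= s -> s < inf S -> P s.
  move=> s0 sm; apply: contrapT => nPs.
  by have := ge_inf Sinf.2 (conj s0 nPs : S s); rewrite leNgt sm.
have Pm : P (inf S).
  by move: m0; rewrite le_eqVlt => /predU1P[<- //|m0]; exact: left.
have [a a0 Pa] := right _ m0 Pm.
have [s [s0 nPs] sa] := inf_adherent a0 Sinf.
have := ge_inf Sinf.2 (conj s0 nPs : S s); rewrite le_eqVlt => /predU1P[ms|ms].
  by apply: nPs; rewrite -ms.
by apply: nPs; rewrite -(subrKC (inf S) s); apply: Pa; [rewrite subr_gt0|rewrite ltrBlDl].
Qed.

(** * The hypergraph distance *)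

Section Distance.
Variables (V : finType) (E : {set {set V}}).

Lemma adj_sym x y : adj E x y = adj E y x.
Proof. by apply: eq_existsb => e; rewrite (andbC (x \in e)). Qed.

Lemma chainb_rcons n x z y : chainb E n x z -> adj E z y -> chainb E n.+1 x y.
Proof.
elim: n x => [|n IH] x /=.
  by move=> /eqP -> zy; apply/existsP; exists y; rewrite zy eqxx.
move=> /existsP[u /andP[xu uz]] zy; apply/existsP; exists u; rewrite xu.
exact: IH.
Qed.

Lemma chainb_sym n x y : chainb E n x y = chainb E n y x.
Proof.
suff h u v : chainb E n u v -> chainb E n v u by apply/idP/idP; exact: h.
elim: n u => [|n IH] u /=; first by rewrite eq_sym.
by move=> /existsP[z /andP[uz /IH zv]]; apply: chainb_rcons zv _; rewrite adj_sym.
Qed.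

Lemma hdist_sym x y : hdist E x y = hdist E y x.
Proof. by apply: eq_bigl => n; exact: chainb_sym. Qed.

Lemma hdist_le_card x y : (hdist E x y <= #|V|)%N.
Proof.
rewrite /hdist; elim/big_ind : _ => // [m n mV nV|n _]; last exact/ltnW.
by rewrite geq_min mV.
Qed.

Lemma hdist_gt0 x y : x != y -> (0 < hdist E x y)%N.
Proof.
move=> xy; rewrite /hdist; elim/big_ind : _ => [|m n m0 n0|n].
- by apply/card_gt0P; exists x.
- by rewrite leq_min m0.
- by case: n => -[|n] //= _; rewrite (negPf xy).
Qed.

End Distance.

Section GradientEstimate.
Variables (R : realType) (V : finType) (E : {set {set V}}) (w : {set V} -> R).
Hypothesis wf : wf_hypergraph E w.
Hypothesis deg_gt0 : forall x, 0 < deg E w x.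
Implicit Types (f g h : V -> R) (l t s : R).
Local Notation ip := (ip E w).
Local Notation J := (resolvent E w).
Local Notation dist x y := ((hdist E x y)%:R : R).
Local Notation dlt x y := (fun z => delta R x z - delta R y z).

Let A_mono g h u v : nLap E w g u -> nLap E w h v -> 0 <= ip (g - h) (u - v).
Proof. exact: nLap_mono. Qed.

Let A_dom g : nLap E w g !=set0.
Proof. exact: nLap_nonempty. Qed.

Let A_res l f : 0 < l -> nLap E w (J l f) (yosida J l f).
Proof. exact: nLap_resolvent. Qed.

Lemma ip_deltaB g x y : ip g (dlt x y) = g x / deg E w x - g y / deg E w y.
Proof.
rewrite -(dotp_deltaB x y (fun z => g z / deg E w z)) /dotp.
by apply: eq_bigr => z _; ring.
Qed.

Lemma Lipw_ip_le f x y : Lipw E w f -> ip f (dlt x y) <= dist x y.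
Proof. by move=> fL; rewrite ip_deltaB (le_trans (ler_norm _))// fL. Qed.

(** The real [sup] is an upper bound only once the set is known to be bounded. Subtract the multiple
    [kd] of the degree that agrees with [g] at [x]: it is fixed by the resolvent and orthogonal to
    [dlt x y], while [g - kd] is bounded through [hdist <= #|V|]. *)
Lemma KD_ubound l x y f : 0 < l -> Lipw E w f -> ip (J l f) (dlt x y) <= KD E w l x y.
Proof.
move=> l0 fL; apply: sup_upper_bound; last by exists f.
split; first by exists (ip (J l f) (dlt x y)), f.
pose C := \sum_z (#|V|%:R ^+ 2 * deg E w z).
exists ((C + ip (dlt x y) (dlt x y)) / 2) => _ [g gL <-].
pose k := g x / deg E w x; pose kd : V -> R := fun z => k * deg E w z.
have Jkd : J l kd = kd by exact: resolvent_deg.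
have -> : ip (J l g) (dlt x y) = ip (J l g - J l kd) (dlt x y).
  by rewrite Jkd ipBl [ip kd _]ip_deltaB /kd !mulfK ?gt_eqF// subrr subr0.
have := ip_young1 deg_gt0 (J l g - J l kd) (dlt x y).
have := resolvent_nonexpansive deg_gt0 A_mono A_res g kd l0.
suff : ip (g - kd) (g - kd) <= C by lra.
apply: ler_sum => z _.
have dz := deg_gt0 z.
have -> : (g - kd) z * (g - kd) z / deg E w z =
    (g z / deg E w z - k) ^+ 2 * deg E w z.
  rewrite (_ : (g - kd) z = g z - k * deg E w z)//; field; exact: lt0r_neq0.
rewrite ler_pM2r// -[leLHS]real_normK ?num_real// ler_pXn2r ?nnegrE//.
by apply: le_trans (gL z x) _; rewrite ler_nat hdist_le_card.
Qed.

Lemma kappa_le_yosida l p x y f : 0 < l -> 0 < p -> x != y ->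
  Lipw E w (p^-1 *: f) -> ip f (dlt x y) = p * dist x y ->
  kappa E w l x y / l * (p * dist x y) <= ip (yosida J l f) (dlt x y).
Proof.
move=> l0 p0 xy fL fxy; have d0 : 0 < dist x y by rewrite ltr0n hdist_gt0.
have := @KD_ubound l x y _ l0 fL.
rewrite (resolvent_scale wf deg_gt0) ?invr_gt0// ipZl ler_pdivrMl// => h.
rewrite /yosida ipZl ipBl fxy /kappa.
rewrite (_ : _ / l * _ = l^-1 * (p * dist x y - p * KD E w l x y)); last first.
  by field; rewrite !lt0r_neq0.
by rewrite ler_pM2l ?invr_gt0// lerD2l lerN2.
Qed.

(** Otherwise the quotient stays below [k - eps] on the whole interval from 0 to [a], which is a
    right neighbourhood of 0 and so bounds the limsup. *)
Lemma kappabar_frequently k eps a x y : (k%:E <= kappabar E w x y)%E ->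
  0 < eps -> 0 < a -> exists l, [/\ 0 < l, l < a & k - eps <= kappa E w l x y / l].
Proof.
move=> kk e0 a0; apply: contrapT => H.
suff : (kappabar E w x y <= (k - eps)%:E)%E.
  by move=> /(le_trans kk); rewrite lee_fin; lra.
pose S := [set l : R | 0 < l /\ l < a].
apply: (@le_trans _ _ (ereal_sup [set (kappa E w l x y / l)%:E | l in S])).
  apply: ereal_inf_lbound; exists S => //.
  near=> l; split; first by near: l; exact: nbhs_right_gt.
  by near: l; exact: nbhs_right_lt.
apply: ge_ereal_sup => _ [l [l0 la] <-]; rewrite lee_fin leNgt; apply/negP => h.
by apply: H; exists l; split=> //; exact: ltW.
Unshelve. all: by end_near.
Qed.

(** This continuity in time controls inactive pairs for short times and lets the barrier pass to
    left limits. *)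
Lemma flow_ip_lipschitz f D : exists2 B, 0 <= B & forall t s, 0 <= s -> s < t ->
  ip (flow J t f) D <= ip (flow J s f) D + (t - s) * B.
Proof.
have [N N0 fN] := yosida_bounded deg_gt0 A_mono A_dom A_res f.
exists ((N + ip D D) / 2); first by rewrite divr_ge0// addr_ge0// ip_ge0.
move=> t s s0 st; have ts : 0 < t - s by rewrite subr_gt0.
have := flow_lipschitz deg_gt0 A_mono A_dom A_res fN (ltW (le_lt_trans s0 st)) s0.
have := @ip_young _ _ _ _ deg_gt0 (t - s)^-1 (flow J t f - flow J s f) D.
rewrite invr_gt0 => /(_ ts); rewrite invrK => yng h.
have : (t - s)^-1 * ip (flow J t f - flow J s f) (flow J t f - flow J s f) <=
    (t - s) * N by rewrite ler_pdivrMl// mulrA -expr2.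
move: yng; set q := (t - s)^-1 * _; rewrite ipBl; lra.
Qed.

Section Barrier.
Variables (k eps : R) (f : V -> R).
Hypothesis eps_gt0 : 0 < eps.
Hypothesis k_le : forall x y, x != y -> (k%:E <= kappabar E w x y)%E.
Hypothesis fL : Lipw E w f.

Let psi t := expR ((eps - k) * t).

(** The exponential lies above its tangent, so a linear comparison suffices in [barrier_step]. *)
Let psiD t s : psi t * (1 + (eps - k) * s) <= psi (t + s).
Proof. by rewrite /psi [in leRHS]mulrDr expRD ler_pM2l ?expR_gt0// expR_ge1Dx. Qed.

Let below t := forall x y, ip (flow J t f) (dlt x y) <= psi t * dist x y.

Lemma barrier_step t : 0 <= t -> below t ->
  exists2 a, 0 < a & forall s, 0 < s -> s < a -> below (t + s).
Proof.
move=> t0 bt; set g := flow J t f in bt; have p0 : 0 < psi t := expR_gt0 _.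
(* Each pair may have its own time span; there are finitely many, so the minimum is positive. *)
suff H (p : V * V) : exists a, 0 < a /\ forall s, 0 < s -> s < a ->
    ip (flow J s g) (dlt p.1 p.2) <= psi t * (1 + (eps - k) * s) * dist p.1 p.2.
  have [a ha] := boolp.choice H.
  exists (\big[Num.min/1]_p a p).
    by elim/big_ind : _ => // [u v u0 v0|p _]; [rewrite lt_min u0|have [] := ha p].
  move=> s s0 sa x y; rewrite (flowD deg_gt0 A_mono A_dom A_res)//.
  apply: le_trans (_ : psi t * (1 + (eps - k) * s) * dist x y <= _); last by rewrite ler_wpM2r.
  have [_] := ha (x, y); apply=> //; apply: lt_le_trans sa _; exact: bigmin_le.
case: p => x y /=; have [->|xy] := eqVneq x y.
  (* On the diagonal the left side is 0, and this span keeps the tangent factor nonnegative. *)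
  exists (1 / (`|eps - k| + 1)); have q0 : 0 < `|eps - k| + 1 by rewrite ltr_wpDl.
  split=> [|s s0]; first by rewrite divr_gt0.
  rewrite ltr_pdivlMr// => sa; rewrite ip_deltaB subrr mulr_ge0// mulr_ge0 ?(ltW p0)//.
  have := ler_norm (- (eps - k)); rewrite normrN; nra.
have d0 : 0 < dist x y by rewrite ltr0n hdist_gt0.
have := bt x y; rewrite le_eqVlt => /predU1P[act|inact].
  have gL : Lipw E w ((psi t)^-1 *: g).
    have gle u v : ip ((psi t)^-1 *: g) (dlt u v) <= dist u v by rewrite ipZl ler_pdivrMl.
    move=> u v; rewrite ler_norml -ip_deltaB gle andbT lerNl.
    by have := gle v u; rewrite hdist_sym !ip_deltaB opprB.
  have pd : 0 < psi t * dist x y by rewrite mulr_gt0.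
  (* One half of [eps] is lost to the limsup, the other to the right derivative; the total matches
     the slope of the tangent exactly. *)
  have e2 : 0 < eps / 2 by rewrite divr_gt0.
  have [a a0 ha] := @flow_right_derivative _ _ _ _ deg_gt0 _ A_mono A_dom _ A_res
    g (dlt x y) ((k - eps / 2) * (psi t * dist x y)) _ (mulr_gt0 e2 pd)
    (fun b b0 => let: ex_intro l (And3 l0 lb kl) := kappabar_frequently (k_le xy) e2 b0 in
      ex_intro _ l (And3 l0 lb (le_trans (ler_wpM2r (ltW pd) kl)
        (kappa_le_yosida l0 p0 xy gL act)))).
  exists a; split=> // s s0 sa; apply: le_trans (ha s s0 sa) _.
  by rewrite act le_eqVlt; apply/orP; left; apply/eqP; field.
have [B B0 hB] := flow_ip_lipschitz g (dlt x y).
(* An inactive pair starts with a positive gap, and [C] bounds the rate at which flow and tangent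
   can close it. *)
pose C := B + `|eps - k| * (psi t * dist x y) + 1.
have C0 : 0 < C by rewrite ltr_wpDl// addr_ge0// mulr_ge0// mulr_ge0// ltW.
exists ((psi t * dist x y - ip g (dlt x y)) / C).
split=> [|s s0]; first by rewrite divr_gt0// subr_gt0.
rewrite ltr_pdivlMr// => sC; have := hB s 0 (lexx _) s0.
rewrite (flow0 J) subr0 => /le_trans; apply.
have h : - (eps - k) * (psi t * dist x y) <= `|eps - k| * (psi t * dist x y).
  by rewrite ler_wpM2r ?mulr_ge0 ?(ltW p0)// -normrN ler_norm.
have := ler_wpM2l (ltW s0) h; move: sC; rewrite /C; lra.
Qed.

Lemma barrier_closed t : 0 < t ->
  (forall s, 0 <= s -> s < t -> below s) -> below t.
Proof.
move=> t0 bs x y; have [B B0 hB] := flow_ip_lipschitz f (dlt x y).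
have idt : (fun s : R => s) @ t^'- --> t.
  by apply: cvg_at_left_filter; exact: cvg_id.
have cpsi : psi s @[s --> t^'-] --> psi t.
  apply: cvg_at_left_filter.
  apply: (@continuous_comp _ _ _ (fun s => (eps - k) * s) expR).
    by apply: cvgM; [exact: cvg_cst|exact: cvg_id].
  exact: continuous_expR.
have cr : psi s * dist x y + (t - s) * B @[s --> t^'-] -->
    psi t * dist x y + (t - t) * B.
  apply: cvgD; first by apply: cvgM => //; exact: cvg_cst.
  apply: cvgM; last exact: cvg_cst.
  by apply: cvgB => //; exact: cvg_cst.
rewrite subrr mul0r addr0 in cr.
apply: ler_cvg_to (cvg_cst _) cr _; near=> s.
have s0 : 0 <= s by apply/ltW; near: s; exact: nbhs_left_gt.
have st : s < t by near: s; exact: nbhs_left_lt.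
by apply: le_trans (hB _ _ s0 st) _; rewrite lerD2r; exact: bs.
Unshelve. all: by end_near.
Qed.

Lemma flow_below_barrier t x y : 0 <= t ->
  ip (flow J t f) (dlt x y) <= expR ((eps - k) * t) * dist x y.
Proof.
move=> t0; apply: (@real_induction _ below) => //.
- by move=> u v; rewrite flow0 /psi mulr0 expR0 mul1r; exact: Lipw_ip_le.
- exact: barrier_step.
- exact: barrier_closed.
Qed.

End Barrier.

Lemma heat_gradient_estimate k f t x y : (forall x y, x != y -> (k%:E <= kappabar E w x y)%E) ->
  Lipw E w f -> 0 <= t ->
  heat E w t f x / deg E w x - heat E w t f y / deg E w y <= expR (- k * t) * dist x y.
Proof.
move=> kk fL t0; rewrite -[leLHS](ip_deltaB (flow J t f)).
have ce : expR ((eps - k) * t) * dist x y @[eps --> 0^'+] -->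
    expR ((0 - k) * t) * dist x y.
  apply: cvgM; last exact: cvg_cst.
  apply: cvg_at_right_filter.
  apply: (@continuous_comp _ _ _ (fun e => (e - k) * t) expR).
    apply: cvgM; last exact: cvg_cst.
    by apply: cvgB; [exact: cvg_id|exact: cvg_cst].
  exact: continuous_expR.
rewrite sub0r in ce; apply: ler_cvg_to (cvg_cst _) ce _; near=> eps.
by apply: flow_below_barrier => //; near: eps; exact: nbhs_right_gt.
Unshelve. all: by end_near.
Qed.

End GradientEstimate.

Theorem mainTheorem15 (R : realType) (V : finType) (E : {set {set V}})
    (w : {set V} -> R) :
  wf_hypergraph E w ->
  connected_hg E ->
  (forall x : V, 0 < deg E w x) ->
  (1 < #|V|)%N ->
  forall (f : V -> R), Lipw E w f ->
  forall (x y : V) (t : R), 0 < t ->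
  ((heat E w t f x / deg E w x - heat E w t f y / deg E w y)%:E
    <= expeR (- (kappa0 E w * t%:E)) * ((hdist E x y)%:R)%:E)%E.
Proof.
move=> wf _ deg_gt0 _ f fL x y t t0.
have [->|xy] := eqVneq x y; first by rewrite subrr mule_ge0 ?expeR_ge0 ?lee_fin.
have d0 : 0 < (hdist E x y)%:R :> R by rewrite ltr0n hdist_gt0.
have est k : (k%:E <= kappa0 E w)%E ->
    heat E w t f x / deg E w x - heat E w t f y / deg E w y <=
    expR (- k * t) * (hdist E x y)%:R.
  move=> kk; apply: heat_gradient_estimate => // [u v uv|]; last exact: ltW.
  by apply: le_trans kk _; apply: ereal_inf_lbound; exists (u, v).
case: (kappa0 E w) est => [k||] est.
- by rewrite -EFinM lee_fin -(mulNr k); exact: est.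
- rewrite gt0_mulye ?lte_fin//= mul0e lee_fin leNgt; apply/negP => X0.
  move: X0 est; set X := _ - _ => X0 est.
  (* For infinite curvature the right side is 0. If [X > 0], this rate together with
     [1 + u <= expR u] gives [X + hdist <= hdist], a contradiction. *)
  have := est ((hdist E x y)%:R / (X * t)) (leey _).
  rewrite mulNr expRN mulrC ler_pdivlMr ?expR_gt0//.
  have := expR_ge1Dx ((hdist E x y)%:R / (X * t) * t).
  move=> /(ler_wpM2l (ltW X0)) h /(le_trans h).
  rewrite (_ : X * (1 + _) = X + (hdist E x y)%:R); first by rewrite gerDr leNgt X0.
  by field; rewrite !lt0r_neq0.
- by rewrite gt0_mulNye ?lte_fin//= gt0_mulye ?lte_fin// leey.
Qed.
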